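(* Let $n\ge 1$, $a,b\in\mathbb{R}^n$ and let $Q\in\mathbb{R}^{n\times n}$ be symmetric positive semidefinite. Consider the two relaxations of the mixed-integer problem (QI) given in the context: the problem (Shor) $$\begin{aligned}\min_{x,y,Z}\ & a'x+b'y+\sum_{i=1}^n\sum_{j=1}^nQ_{ij}Z_{ij}\\ \text{s.t. } & y_i-Z_{i,i+n}=0,\quad x_i-Z_{i+n,i+n}=0,\qquad i=1,\dots,n,\\ & Z-\begin{pmatrix}y\\ x\end{pmatrix}\begin{pmatrix}y'&x'\end{pmatrix}\succeq 0,\\ &0\le x\le 1,\ y\ge 0,\end{aligned}$$ over $x,y\in\mathbb{R}^n$ and symmetric $Z\in\mathbb{R}^{2n\times 2n}$, and the problem (OptPersp) $$\begin{aligned}\min_{x,y,Y}\ & a'x+b'y+\langle Q,Y\rangle\\ \text{s.t. } & Y-yy'\succeq 0,\\ & y_i^2\le Y_{ii}x_i,\qquad i=1,\dots,n,\\ &0\le x\le 1,\ y\ge 0,\end{aligned}$$ over $x,y\in\mathbb{R}^n$ and symmetric $Y\in\mathbb{R}^{n\times n}$. Then (Shor) and (OptPersp) are equivalent.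
   Context: A prime denotes transpose, $\langle Q,Y\rangle=\sum_{i,j}Q_{ij}Y_{ij}$, and $A\succeq 0$ means that $A$ is symmetric positive semidefinite. Inequalities between vectors are componentwise. Problem (QI) is $\min\{a'x+b'y+y'Qy:(x,y)\in\mathcal I_n\}$ with $\mathcal I_n=\{(x,y)\in\{0,1\}^n\times\mathbb{R}^n_+: y_i(1-x_i)=0 \text{ for all } i=1,\dots,n\}$. A relaxation A is at least as strong as a relaxation B if, for every instance $(a,b,Q)$, the optimal value (infimum) of A is at least that of B. Two relaxations are equivalent if each is at least as strong as the other, i.e., they have the same optimal value for every instance. *)

(* Defs.v *)
From HB Require Import structures.
From mathcomp Require Import all_boot all_order all_algebra.
From mathcomp Require Import classical_sets reals constructive_ereal ereal.

Set Implicit Arguments.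
Unset Strict Implicit.
Unset Printing Implicit Defensive.

Import Order.TTheory GRing.Theory Num.Theory.
Local Open Scope ring_scope.
Local Open Scope classical_set_scope.

Definition psdmx (R : realType) (n : nat) (A : 'M[R]_n) : Prop :=
  A^T = A /\ forall u : 'cV[R]_n, 0 <= (u^T *m A *m u) 0 0.

Record min_problem (R : realType) := MinProblem {
  variables : Type;
  feasible : set variables;
  objective : variables -> R
}.

(* The infimum is taken in the extended reals, so that it exists for every
   instance: it need not be attained, and it is -oo if the objective is
   unbounded below on the feasible set. *)
Definition opt_value (R : realType) (P : min_problem R) : \bar R :=
  ereal_inf [set (objective v)%:E | v in @feasible R P].

Definition relaxation (R : realType) (n : nat) :=
  'cV[R]_n -> 'cV[R]_n -> 'M[R]_n -> min_problem R.

Definition at_least_as_strong (R : realType) (n : nat)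
    (A B : relaxation R n) : Prop :=
  forall (a b : 'cV[R]_n) (Q : 'M[R]_n), psdmx Q ->
    (opt_value (B a b Q) <= opt_value (A a b Q))%E.

Definition equivalent_relaxations (R : realType) (n : nat)
    (A B : relaxation R n) : Prop :=
  at_least_as_strong A B /\ at_least_as_strong B A.

Definition box_constraints (R : realType) (n : nat) (x y : 'cV[R]_n) : Prop :=
  forall i, 0 <= x i 0 <= 1 /\ 0 <= y i 0.

(* Z is indexed by 'I_(n + n): [lshift n i] is the index i of the y-block and
   [rshift n i] the index i + n of the x-block. *)
Definition shor_feasible (R : realType) (n : nat) (x y : 'cV[R]_n)
    (Z : 'M[R]_(n + n)) : Prop :=
  [/\ Z^T = Z,
      forall i, y i 0 - Z (lshift n i) (rshift n i) = 0,
      forall i, x i 0 - Z (rshift n i) (rshift n i) = 0,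
      psdmx (Z - col_mx y x *m row_mx y^T x^T)
    & box_constraints x y].

Definition shor (R : realType) (n : nat) : relaxation R n := fun a b Q =>
  {| variables := ('cV[R]_n * 'cV[R]_n * 'M[R]_(n + n))%type;
     feasible := [set v | let: (x, y, Z) := v in shor_feasible x y Z];
     objective := fun v => let: (x, y, Z) := v in
       (a^T *m x) 0 0 + (b^T *m y) 0 0
       + \sum_(i < n) \sum_(j < n) Q i j * Z (lshift n i) (lshift n j) |}.

Definition opt_persp_feasible (R : realType) (n : nat) (x y : 'cV[R]_n)
    (Y : 'M[R]_n) : Prop :=
  [/\ Y^T = Y,
      psdmx (Y - y *m y^T),
      forall i, y i 0 ^+ 2 <= Y i i * x i 0
    & box_constraints x y].

Definition opt_persp (R : realType) (n : nat) : relaxation R n := fun a b Q =>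
  {| variables := ('cV[R]_n * 'cV[R]_n * 'M[R]_n)%type;
     feasible := [set v | let: (x, y, Y) := v in opt_persp_feasible x y Y];
     objective := fun v => let: (x, y, Y) := v in
       (a^T *m x) 0 0 + (b^T *m y) 0 0
       + \sum_(i < n) \sum_(j < n) Q i j * Y i j |}.

(* Main.v *)
Require Import Defs.
From mathcomp Require Import all_boot all_order all_algebra.
From mathcomp Require Import classical_sets reals constructive_ereal ereal.
From mathcomp Require Import ring lra.

(** The two problems have the same attainable triples (x, y, upper-left block
    of Z), so their objectives take the same values.

    Projecting a feasible Z: the upper-left block of Z - vv', with v = (y; x),
    is Y - yy', so it is positive semidefinite.  Moreover Z itself is positive
    semidefinite, being the sum of Z - vv' and vv', and its 2 x 2 minor on the
    indices i and i + n reads y_i^2 <= Y_ii x_i because Z_{i,i+n} = y_i and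
    Z_{i+n,i+n} = x_i.

    Lifting a feasible Y: put A = Y - yy'.  Only the diagonals of the blocks
    of Z - vv' other than A are prescribed: y_i - y_i x_i for the upper-right
    one and x_i - x_i^2 for the lower-right one.  Such a matrix can be
    completed from its diagonals alone (lemma [psdmx_block_completion]):
    scale A on both sides by (I; D) with D diagonal, which fixes the
    off-diagonal block, and add the missing nonnegative slack to the diagonal
    of the lower-right block.  This is possible as soon as
    (y_i - y_i x_i)^2 <= A_ii (x_i - x_i^2) for every i, and that inequality
    is (1 - x_i) times the perspective constraint y_i^2 <= Y_ii x_i. *)

Set Implicit Arguments.
Unset Strict Implicit.
Unset Printing Implicit Defensive.

Import Order.TTheory GRing.Theory Num.Theory.
Local Open Scope ring_scope.
Local Open Scope classical_set_scope.

Lemma psdmxD (R : realType) (n : nat) (A B : 'M[R]_n) :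
  psdmx A -> psdmx B -> psdmx (A + B).
Proof.
move=> [symA posA] [symB posB]; split; first by rewrite linearD /= symA symB.
by move=> u; rewrite mulmxDr mulmxDl mxE addr_ge0.
Qed.

Lemma psdmx_congr (R : realType) (m n : nat) (P : 'M[R]_(m, n)) (A : 'M[R]_n) :
  psdmx A -> psdmx (P *m A *m P^T).
Proof.
move=> [symA posA]; split; first by rewrite !trmx_mul trmxK symA mulmxA.
by move=> u; have := posA (P^T *m u); rewrite trmx_mul trmxK !mulmxA.
Qed.

Lemma psdmx_diag (R : realType) (n : nat) (d : 'rV[R]_n) :
  (forall i, 0 <= d 0 i) -> psdmx (diag_mx d).
Proof.
move=> d_ge0; split; first by rewrite tr_diag_mx.
move=> u; rewrite mul_mx_diag mxE sumr_ge0 // => i _.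
by rewrite !mxE mulrAC mulr_ge0 // -expr2 sqr_ge0.
Qed.

Lemma psdmx_gram (R : realType) (m n : nat) (P : 'M[R]_(m, n)) :
  psdmx (P *m P^T).
Proof.
have psd1 : psdmx (1%:M : 'M[R]_n).
  by rewrite -diag_const_mx; apply: psdmx_diag => i; rewrite mxE ler01.
by have := psdmx_congr P psd1; rewrite mulmx1.
Qed.

Lemma psdmx_ulsubmx (R : realType) (m n : nat) (A : 'M[R]_(m + n)) :
  psdmx A -> psdmx (ulsubmx A).
Proof.
move=> /(psdmx_congr (row_mx 1%:M 0)); rewrite -{1}[A]submxK.
rewrite tr_row_mx mul_row_block mul_row_col trmx1 trmx0.
by rewrite !mul1mx !mul0mx !mulmx0 mulmx1 !addr0.
Qed.

Lemma psdmx_quad2 (R : realType) (n : nat) (A : 'M[R]_n) i j (s t : R) :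
  psdmx A ->
  0 <= s ^+ 2 * A i i + s * t * A i j *+ 2 + t ^+ 2 * A j j.
Proof.
move=> [symA posA].
have Aji : A j i = A i j by rewrite -{1}symA mxE.
pose u := s *: delta_mx i 0 + t *: delta_mx j 0 : 'cV[R]_n.
have uT : u^T = s *: delta_mx 0 i + t *: delta_mx 0 j.
  by rewrite linearD !linearZ /= !trmx_delta.
have := posA u; rewrite uT /u !mulmxDl !mulmxDr.
rewrite -!scalemxAl -!rowE -!scalemxAr -!colE !mxE Aji.
by congr (_ <= _); ring.
Qed.

Lemma psdmx_diag_ge0 (R : realType) (n : nat) (A : 'M[R]_n) i :
  psdmx A -> 0 <= A i i.
Proof. by move=> /(psdmx_quad2 i i 1 0); congr (_ <= _); ring. Qed.

Lemma psdmx_minor2 (R : realType) (n : nat) (A : 'M[R]_n) i j :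
  psdmx A -> A i j ^+ 2 <= A i i * A j j.
Proof.
move=> psdA; have Aii := psdmx_diag_ge0 i psdA.
have := psdmx_diag_ge0 j psdA; rewrite le_eqVlt => /predU1P[Ajj0|Ajj_gt0].
  (* The vector A_ij e_i - (A_ii + 1) e_j has value - A_ij^2 (A_ii + 2). *)
  have := psdmx_quad2 i j (A i j) (- (A i i + 1)) psdA.
  by rewrite -Ajj0; nra.
(* The vector A_jj e_i - A_ij e_j has value A_jj times the minor. *)
have := psdmx_quad2 i j (A j j) (- A i j) psdA.
have -> : A j j ^+ 2 * A i i + A j j * - A i j * A i j *+ 2
    + (- A i j) ^+ 2 * A j j = A j j * (A i i * A j j - A i j ^+ 2) by ring.
by rewrite pmulr_rge0 // subr_ge0.
Qed.

(** The principal minors on the indices i and i + n are the only obstruction to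
    prescribing the diagonals of the two new blocks: with D = diag(b_i / A_ii),
    the matrix (I; D) A (I, D) has the required off-diagonal entries b_i, and
    its lower-right diagonal b_i^2 / A_ii is at most c_i. *)
Lemma psdmx_block_completion (R : realType) (n : nat) (A : 'M[R]_n)
    (b c : 'I_n -> R) :
    psdmx A -> (forall i, 0 <= c i) -> (forall i, b i ^+ 2 <= A i i * c i) ->
  exists M : 'M[R]_(n + n),
    [/\ psdmx M, ulsubmx M = A,
        forall i, M (lshift n i) (rshift n i) = b i
      & forall i, M (rshift n i) (rshift n i) = c i].
Proof.
move=> psdA c_ge0 minor.
(* Where A_ii = 0 the hypothesis forces b_i = 0, and division by 0 gives
   d_i = 0, so the two properties of d below hold in that case as well. *)
pose d := \row_i (b i / A i i).
have Ad i : A i i * d 0 i = b i.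
  rewrite mxE; case: (eqVneq (A i i) 0) => [Aii0|Aii_neq0]; last first.
    by rewrite mulrCA mulfV ?mulr1.
  have := minor i; rewrite Aii0 !mul0r => b2_le0.
  by apply/esym/eqP; rewrite -sqrf_eq0 eq_le b2_le0 sqr_ge0.
have db_le i : d 0 i * b i <= c i.
  have := psdmx_diag_ge0 i psdA; rewrite le_eqVlt => /predU1P[Aii0|Aii_gt0].
    by rewrite -Ad -Aii0 mul0r mulr0 c_ge0.
  by rewrite mxE mulrAC -expr2 ler_pdivrMr // mulrC minor.
pose r : 'rV[R]_n := \row_i (c i - d 0 i * b i).
pose P : 'M[R]_(n + n, n) := col_mx 1%:M (diag_mx d).
have PAP : P *m A *m P^T = block_mx A (A *m diag_mx d) (diag_mx d *m A)
                              (diag_mx d *m A *m diag_mx d).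
  by rewrite tr_col_mx trmx1 tr_diag_mx mul_col_mx mul1mx mul_col_row !mulmx1.
exists (P *m A *m P^T + diag_mx (row_mx 0 r)); split.
- apply: psdmxD; first exact: psdmx_congr.
  apply: psdmx_diag => i; rewrite -[i]splitK; case: (split i) => k /=.
    by rewrite row_mxEl mxE.
  by rewrite row_mxEr mxE subr_ge0.
- rewrite PAP diag_mx_row add_block_mx block_mxKul.
  by rewrite linear0 addr0.
- move=> i; rewrite PAP diag_mx_row add_block_mx block_mxEur addr0.
  by rewrite mul_mx_diag mxE Ad.
- move=> i; rewrite PAP diag_mx_row add_block_mx block_mxEdr mxE.
  rewrite mul_mx_diag mxE mul_diag_mx mxE [diag_mx r i i]mxE eqxx mulr1n.
  by rewrite [r 0 i]mxE -Ad; ring.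
Qed.

Lemma opt_value_le (R : realType) (P P' : min_problem R) :
  (forall v, @feasible R P' v ->
     exists2 w, @feasible R P w & objective w = objective v) ->
  (opt_value P <= opt_value P')%E.
Proof.
move=> h; apply: le_ereal_inf => _ [v fv <-].
by have [w fw <-] := h v fv; exists w.
Qed.

Lemma shor_feasible_projection (R : realType) (n : nat) (x y : 'cV[R]_n)
    (Z : 'M[R]_(n + n)) :
  shor_feasible x y Z -> opt_persp_feasible x y (ulsubmx Z).
Proof.
move=> [symZ Zy Zx psdM box]; split=> //.
- by rewrite trmx_ulsub symZ.
- have := psdmx_ulsubmx psdM.
  by rewrite mul_col_row -{1}[Z]submxK opp_block_mx add_block_mx block_mxKul.
- move=> i; have psdZ : psdmx Z.
    have := psdmxD psdM (psdmx_gram (col_mx y x)).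
    by rewrite tr_col_mx subrK.
  have := psdmx_minor2 (lshift n i) (rshift n i) psdZ.
  by rewrite -(subr0_eq (Zy i)) -(subr0_eq (Zx i)) !mxE.
Qed.

Lemma opt_persp_feasible_lift (R : realType) (n : nat) (x y : 'cV[R]_n)
    (Y : 'M[R]_n) :
  opt_persp_feasible x y Y ->
  exists2 Z, shor_feasible x y Z & ulsubmx Z = Y.
Proof.
move=> [symY psdA persp box].
have outer (u v : 'cV[R]_n) i j : (u *m v^T) i j = u i 0 * v j 0.
  by rewrite mxE big_ord1 mxE.
have [|i|M [psdM ulM urM drM]] :=
    psdmx_block_completion (b := fun i => y i 0 - y i 0 * x i 0)
      (c := fun i => x i 0 - x i 0 * x i 0) psdA.
- by move=> i; have [/andP[x0 x1] _] := box i; nra.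
- rewrite 2!mxE outer -subr_ge0.
  have [/andP[_ x1] _] := box i.
  have : 0 <= (1 - x i 0) * (Y i i * x i 0 - y i 0 ^+ 2).
    by rewrite mulr_ge0 // subr_ge0.
  by congr (_ <= _); ring.
have blockE : col_mx y x *m row_mx y^T x^T =
    block_mx (y *m y^T) (y *m x^T) (x *m y^T) (x *m x^T).
  by rewrite mul_col_row.
exists (M + col_mx y x *m row_mx y^T x^T); first split=> //.
- have [symM _] := psdM.
  by rewrite linearD /= symM trmx_mul tr_row_mx tr_col_mx !trmxK.
- by move=> i; rewrite mxE urM blockE block_mxEur outer /=; ring.
- by move=> i; rewrite mxE drM blockE block_mxEdr outer /=; ring.
- by rewrite addrK.
- by rewrite -[M]submxK ulM blockE add_block_mx block_mxKul subrK.
Qed.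

Theorem theorem1 (R : realType) (n : nat) (hn : (1 <= n)%N) :
  equivalent_relaxations (@shor R n) (@opt_persp R n).
Proof.
split=> a b Q _; apply: opt_value_le.
- move=> [[x y] Z] /= /shor_feasible_projection fY.
  exists (x, y, ulsubmx Z) => //=; congr (_ + _).
  by apply: eq_bigr => i _; apply: eq_bigr => j _; rewrite !mxE.
- move=> [[x y] Y] /= /opt_persp_feasible_lift[Z fZ <-].
  exists (x, y, Z) => //=; congr (_ + _).
  by apply: eq_bigr => i _; apply: eq_bigr => j _; rewrite !mxE.
Qed.
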